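(* Let $d\ge1$, $0<\mu\le L<\infty$, and let $k\ge 1$ be an integer. For $\gamma\in[0,\frac2L]$, consider the worst-case values of the proximal gradient method with constant step size $\gamma$ after $k$ iterations, $$W_1(\gamma)=\sup\frac{\|x_k-x_\star\|^2}{\|x_0-x_\star\|^2},\qquad W_2(\gamma)=\sup\frac{\|\nabla f(x_k)+s_k\|^2}{\|\tilde\nabla F(x_0)\|^2}\ (\gamma>0),\qquad W_3(\gamma)=\sup\frac{F(x_k)-F(x_\star)}{F(x_0)-F(x_\star)},$$ where the suprema are over all $f\in\mathcal{F}_{\mu,L}(\mathbb{R}^d)$, $h\in\mathcal{F}_{0,\infty}(\mathbb{R}^d)$, $x_0\in\mathbb{R}^d$ (and, for $W_2$, over $x_0$ with $\partial F(x_0)\ne\emptyset$ and all $\tilde\nabla F(x_0)\in\partial F(x_0)$) for which the denominator is nonzero and finite. Then the step size $\gamma_\star=\frac{2}{L+\mu}$ minimizes each of $W_1$ and $W_3$ over $[0,\frac2L]$ and minimizes $W_2$ over $(0,\frac2L]$, and $$W_1(\gamma_\star)=W_2(\gamma_\star)=W_3(\gamma_\star)=\left(\frac{L-\mu}{L+\mu}\right)^{2k}.$$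
   Context: $\|\cdot\|$ is the Euclidean norm on $\mathbb{R}^d$. $\mathcal{F}_{0,\infty}(\mathbb{R}^d)$ is the class of closed proper convex functions $h:\mathbb{R}^d\to\mathbb{R}\cup\{\infty\}$. $\mathcal{F}_{\mu,L}(\mathbb{R}^d)$ is the class of functions $f:\mathbb{R}^d\to\mathbb{R}$ that are differentiable on all of $\mathbb{R}^d$, $L$-smooth ($\|\nabla f(x+\Delta x)-\nabla f(x)\|\le L\|\Delta x\|$ for all $x,\Delta x\in\mathbb{R}^d$) and $\mu$-strongly convex ($x\mapsto f(x)-\frac{\mu}{2}\|x\|^2$ is convex on $\mathbb{R}^d$). $F=f+h$, $x_\star$ is the unique minimizer of $F$, and $\partial$ denotes the convex subdifferential. The proximal operator is $\mathbf{p}_{\gamma h}(x)=\operatorname{argmin}_{y\in\mathbb{R}^d}\{\gamma h(y)+\frac12\|x-y\|^2\}$; for $\gamma=0$ we use the convention $\mathbf{p}_{0h}(x)=x$. The proximal gradient method with step size $\gamma$ started at $x_0$ generates $x_{k+1}=\mathbf{p}_{\gamma h}(x_k-\gamma\nabla f(x_k))$ for $k\ge 0$. For $\gamma>0$ and $k\ge1$, $s_k=\frac{x_{k-1}-x_k}{\gamma}-\nabla f(x_{k-1})$. *)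

(* Defs.v *)
From HB Require Import structures.
From mathcomp Require Import all_boot all_order all_algebra.
From mathcomp Require Import all_classical all_reals all_analysis.
Import Order.TTheory GRing.Theory Num.Theory.
Import numFieldNormedType.Exports.

Set Implicit Arguments.
Unset Strict Implicit.
Unset Printing Implicit Defensive.

Local Open Scope classical_set_scope.
Local Open Scope ring_scope.

Section Definitions.
Context {R : realType} {d : nat}.
Local Notation E := 'rV[R]_d.
Implicit Types (x y v : E) (f : E -> R) (h : E -> \bar R) (mu L gamma : R).

Definition dotp x y : R := \sum_(i < d) x 0 i * y 0 i.

(* The library norm on matrices is the sup norm, hence a separate Euclidean
   norm; since all norms on E are equivalent, [differentiable] and [closed]
   below are nevertheless the usual Euclidean notions. *)
Definition enorm x : R := Num.sqrt (dotp x x).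

Definition gradient f x : E := \row_(i < d) 'D_(delta_mx 0 i) f x.

(* F_{mu,L}(R^d) *)
Definition smooth_strongly_convex mu L f : Prop :=
  [/\ forall x, differentiable f x,
      forall x dx,
        enorm (gradient f (x + dx) - gradient f x) <= L * enorm dx &
      convex_function (E := E) setT
        (fun x => f x - mu / 2 * enorm x ^+ 2)].

Definition epigraph h : set (E * R) := [set p | (h p.1 <= p.2%:E)%E].

(* Restricting to 0 < t < 1 keeps 0 * +oo out of Jensen's inequality. *)
Definition convex_ext h : Prop :=
  forall x y (t : R), 0 < t < 1 ->
    (h (t *: x + (1 - t) *: y)%R <= t%:E * h x + (1 - t)%:E * h y)%E.

(* F_{0,oo}(R^d) *)
Definition closed_proper_convex h : Prop :=
  [/\ closed (epigraph h),
      forall x, h x != -oo%E,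
      exists x, h x != +oo%E &
      convex_ext h].

Definition subdifferential h x : set E :=
  [set v | forall y, (h x + (dotp v (y - x))%:E <= h y)%E].

(* A minimizer, as a point; it exists and is unique for the strongly convex
   closed proper functions to which it is applied below (the value chosen when
   there is none, here 0, is thus irrelevant). *)
Definition argmin h : E := xget 0 [set x | forall y, (h x <= h y)%E].

Definition prox gamma h x : E :=
  if gamma == 0 then x
  else argmin (fun y => gamma%:E * h y + (2^-1 * enorm (x - y) ^+ 2)%:E)%E.

Definition pgm gamma f h (x0 : E) (k : nat) : E :=
  iter k (fun x => prox gamma h (x - gamma *: gradient f x)) x0.

(* s_k, for k >= 1 and gamma > 0 *)
Definition prox_subgrad gamma f h (x0 : E) (k : nat) : E :=
  gamma^-1 *: (pgm gamma f h x0 k.-1 - pgm gamma f h x0 k)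
    - gradient f (pgm gamma f h x0 k.-1).

Definition composite f h : E -> \bar R := fun x => ((f x)%:E + h x)%E.

End Definitions.

Section WorstCase.
Context {R : realType}.
Variables (d : nat) (mu L : R) (k : nat) (gamma : R).
Local Notation E := 'rV[R]_d.

Definition W1 : \bar R :=
  ereal_sup [set r | exists (f : E -> R) (h : E -> \bar R) (x0 : E),
    let xstar := argmin (composite f h) in
    let xk := pgm gamma f h x0 k in
    [/\ smooth_strongly_convex mu L f,
        closed_proper_convex h,
        enorm (x0 - xstar) ^+ 2 != 0 &
        r = (enorm (xk - xstar) ^+ 2 / enorm (x0 - xstar) ^+ 2)%:E]].

Definition W2 : \bar R :=
  ereal_sup [set r | exists (f : E -> R) (h : E -> \bar R) (x0 g0 : E),
    let xk := pgm gamma f h x0 k in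
    let sk := prox_subgrad gamma f h x0 k in
    [/\ smooth_strongly_convex mu L f,
        closed_proper_convex h,
        subdifferential (composite f h) x0 g0,
        enorm g0 ^+ 2 != 0 &
        r = (enorm (gradient f xk + sk) ^+ 2 / enorm g0 ^+ 2)%:E]].

Definition W3 : \bar R :=
  ereal_sup [set r | exists (f : E -> R) (h : E -> \bar R) (x0 : E),
    let F := composite f h in
    let xstar := argmin F in
    let xk := pgm gamma f h x0 k in
    [/\ smooth_strongly_convex mu L f,
        closed_proper_convex h,
        (F x0 - F xstar != 0)%E,
        (F x0 - F xstar)%E \is a fin_num &
        r = ((F xk - F xstar) / (F x0 - F xstar))%E]].

End WorstCase.

Definition minimizes_over {R : realType} (W : R -> \bar R) (D : set R)
    (gamma : R) : Prop :=
  D gamma /\ forall gamma', D gamma' -> (W gamma <= W gamma')%E.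

(* Main.v *)
Require Import Defs.
From mathcomp Require Import all_boot all_order all_algebra.
From mathcomp Require Import all_classical all_reals all_analysis.
From mathcomp Require Import ring lra.
Import Order.TTheory GRing.Theory Num.Theory.
Import numFieldNormedType.Exports.

Set Implicit Arguments.
Unset Strict Implicit.
Unset Printing Implicit Defensive.

Local Open Scope classical_set_scope.
Local Open Scope ring_scope.

(** Upper bounds. All that is used of [f] is
    [mu/2 |y-x|^2 <= f y - f x - <grad f x, y-x> <= L/2 |y-x|^2]; it makes the
    gradient step with [gamma = 2/(L+mu)] a contraction of factor
    [rho = (L-mu)/(L+mu)]. Distances contract since the proximal step is
    nonexpansive. For gradients, [grad f x1 + s1] is [1/gamma] times the
    difference of the gradient steps at [x0] and [x1], and
    [|x0 - x1|/gamma = |grad f x0 + s1| <= |grad f x0 + s0|] by monotonicity of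
    the subdifferential of [h]. For values, the interpolation inequalities
    [f0 >= f1], [f* >= f0], [f* >= f1] with weights [rho], [rho(1-rho)], [1-rho] and
    the subgradient inequalities of [h] at [x1] towards [x0] and [x*] with
    weights [rho^2], [1-rho^2] sum up to the one-step decrease plus two squares.

    Lower bounds. With [h = 0], the quadratics [c/2 |x|^2], [c = mu] or
    [c = L], give the ratio [(1 - gamma c)^(2k)] for all three measures. *)

(* Proves an identity between linear combinations of inner products by
   checking it on the summands, coordinate by coordinate. *)
Ltac dotp_field :=
  rewrite /dotp; do ?[progress rewrite -?sumrN ?mulr_sumr ?mulr_suml -?big_split /=];
  apply: eq_bigr => i _; rewrite ?mxE; field; try done.

(** * Inner product, Euclidean norm and compact balls *)

Section EuclideanSpace.
Context {R : realType} {d : nat}.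
Local Notation E := 'rV[R]_d.
Implicit Types (x y v : E) (t : R).

Lemma dotpC x y : dotp x y = dotp y x.
Proof. dotp_field. Qed.

Lemma dotpBl x y v : dotp (x - y) v = dotp x v - dotp y v.
Proof. dotp_field. Qed.

Lemma dotpBr x y v : dotp v (x - y) = dotp v x - dotp v y.
Proof. dotp_field. Qed.

Lemma dotpZl t x y : dotp (t *: x) y = t * dotp x y.
Proof. dotp_field. Qed.

Lemma dotpZr t x y : dotp x (t *: y) = t * dotp x y.
Proof. dotp_field. Qed.

Lemma dotp0 x : dotp x 0 = 0.
Proof. by rewrite -(scale0r 0) dotpZr mul0r. Qed.

Lemma dotp_ge0 x : 0 <= dotp x x.
Proof. by apply: sumr_ge0 => i _; rewrite -expr2 sqr_ge0. Qed.

Lemma dotp_eq0 x : dotp x x = 0 -> x = 0.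
Proof.
move=> /eqP; rewrite psumr_eq0 => [/allP x0|i _]; last by rewrite -expr2 sqr_ge0.
apply/rowP => i; rewrite mxE; apply/eqP.
by have := x0 i (mem_index_enum i); rewrite -expr2 sqrf_eq0.
Qed.

Lemma enorm_sqr x : enorm x ^+ 2 = dotp x x.
Proof. exact/sqr_sqrtr/dotp_ge0. Qed.

Lemma enorm_ge0 x : 0 <= enorm x.
Proof. exact: sqrtr_ge0. Qed.

Lemma enormZ t x : enorm (t *: x) = `|t| * enorm x.
Proof.
by rewrite /enorm dotpZl dotpZr mulrA -expr2 sqrtrM ?sqr_ge0// sqrtr_sqr.
Qed.

(** Cauchy-Schwarz, from the squared norm of [enorm x *: y - (dotp x y / enorm x) *: x]. *)
Lemma dotp_le x y : dotp x y <= enorm x * enorm y.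
Proof.
have := enorm_ge0 x; rewrite le_eqVlt => /predU1P[x0|x_gt0].
  have -> : x = 0 by apply: dotp_eq0; rewrite -enorm_sqr -x0 expr0n.
  by rewrite dotpC dotp0 mulr_ge0 ?enorm_ge0.
have := dotp_ge0 (enorm x *: y - (dotp x y / enorm x) *: x).
have -> : dotp (enorm x *: y - (dotp x y / enorm x) *: x)
   (enorm x *: y - (dotp x y / enorm x) *: x) =
   (enorm x * enorm y) ^+ 2 - dotp x y ^+ 2.
  rewrite !(dotpBl, dotpBr, dotpZl, dotpZr) exprMn -!enorm_sqr (dotpC y x).
  by field; rewrite gt_eqF.
rewrite subr_ge0; apply: contraTT; rewrite -!ltNge => lt.
have N0 : 0 <= enorm x * enorm y by rewrite mulr_ge0 ?enorm_ge0.
by rewrite ltr_sqr // nnegrE (le_trans N0 (ltW lt)).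
Qed.

Lemma dotp_ge x y : - (enorm x * enorm y) <= dotp x y.
Proof.
have := dotp_le (-1 *: x) y; rewrite enormZ dotpZl normrN1; lra.
Qed.

(** Bounds the sup norm, in which the library measures boundedness, by the Euclidean one. *)
Lemma coord_le_enorm x i : `|x 0 i| <= enorm x.
Proof.
rewrite -ler_sqr ?nnegrE ?enorm_ge0 // enorm_sqr /dotp (bigD1 i) //=.
rewrite real_normK ?num_real // expr2 lerDl.
by apply: sumr_ge0 => j _; rewrite -expr2 sqr_ge0.
Qed.

Lemma sqr_norm_sumE :
  (fun y : E => dotp y y) =
  \sum_(i < d) ((fun y : E => y 0 i : R) * (fun y : E => y 0 i : R)).
Proof. by apply/funext => y; rewrite fct_sumE. Qed.

Lemma sqr_norm_differentiable x : differentiable (fun y : E => dotp y y) x.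
Proof.
rewrite sqr_norm_sumE; apply: differentiable_sum => i.
by apply: differentiableM; exact: differentiable_coord.
Qed.

Lemma coord_is_derive x v i : is_derive x v (fun y : E => y 0 i : R) (v 0 i).
Proof.
have dfx := differentiable_coord x 0 i.
apply: DeriveDef; first exact: diff_derivable.
rewrite /derive; apply: cvg_lim => //=.
apply: cvg_near_cst; near=> t; rewrite !mxE addrK scalerA mulVf ?scale1r //.
by near: t; exact: nbhs_dnbhs_neq.
Unshelve. all: by end_near. Qed.

Lemma sqr_norm_is_derive x v : is_derive x v (fun y : E => dotp y y) (2 * dotp x v).
Proof.
rewrite sqr_norm_sumE (_ : 2 * _ = \sum_(i < d) (x 0 i *: v 0 i + x 0 i *: v 0 i)).
  by apply: is_derive_sum => i; apply: is_deriveM; exact: coord_is_derive.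
by rewrite mulr_sumr; apply: eq_bigr => i _; rewrite mulr_natl mulr2n.
Qed.

Lemma sqr_dist_continuous x : continuous (fun y => dotp (x - y) (x - y)).
Proof.
have sub_cont : continuous (fun y : E => x - y).
  by move=> y; apply: continuousB => //; exact: cst_continuous.
have sqr_cont : continuous (fun y : E => dotp y y).
  by move=> y; exact/differentiable_continuous/sqr_norm_differentiable.
move=> y; exact: continuous_comp (sub_cont y) (sqr_cont (x - y)).
Qed.

Lemma closed_eball_compact x (r : R) :
  compact [set y | dotp (x - y) (x - y) <= r ^+ 2].
Proof.
apply: bounded_closed_compact; last first.
  rewrite (_ : [set _ | _] =
    (fun y => dotp (x - y) (x - y)) @^-1` [set t | t <= r ^+ 2])//.
  by apply: closed_comp => [y _|]; [exact: sqr_dist_continuous|exact: closed_le].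
exists (`|x| + `|r|); split; first by rewrite num_real.
move=> M /ltW leM y /= yr; apply: le_trans leM.
suff : `|x - y| <= `|r|.
  have := ler_normB x (x - y); rewrite opprB addrC subrK; lra.
rewrite [leLHS]/Num.norm /= mx_normrE; apply: bigmax_le => [|[i j] _ /=]; first exact: normr_ge0.
rewrite ord1 (le_trans (coord_le_enorm _ _)) //.
by rewrite -ler_sqr ?nnegrE ?enorm_ge0 // enorm_sqr real_normK ?num_real.
Qed.

End EuclideanSpace.

(** * First-order bounds for smooth strongly convex functions *)

(** Divide by [t] and let [t] tend to 0. This turns inequalities along a segment with a quadratic
    error into first-order ones. *)
Lemma le0_of_le_sqr (R : realType) (a c : R) :
  (forall t, 0 < t < 1 -> t * a <= t ^+ 2 * c) -> a <= 0.
Proof.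
move=> H; rewrite leNgt; apply/negP => a0.
have c0 : 0 < 2 * `|c| + 2 * a by rewrite ltr_wpDl ?mulr_ge0 ?mulr_gt0.
(* Chosen so that [t |c| < a / 2], against [a <= t c]. *)
pose t := a / (2 * `|c| + 2 * a).
have t01 : 0 < t < 1.
  rewrite divr_gt0 //= ltr_pdivrMr // mul1r ltr_wpDl ?mulr_ge0 //; lra.
have t0 : 0 < t by case/andP: t01.
have := H t t01; rewrite expr2 -mulrA ler_pM2l // => act.
have : t * c <= t * `|c| by rewrite ler_pM2l // ler_norm.
have -> : t * `|c| = a / 2 - t * a by rewrite /t; field; rewrite gt_eqF.
have := mulr_gt0 t0 a0; lra.
Qed.

Section Smooth.
Context {R : realType} {d : nat}.
Local Notation E := 'rV[R]_d.
Implicit Types (x y v : E) (f : E -> R) (g : E -> E) (mu L : R).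

Lemma derive_gradient f x v : differentiable f x ->
  'D_v f x = dotp (gradient f x) v.
Proof.
move=> df; rewrite deriveE // {1}(row_sum_delta v) linear_sum /dotp.
by apply: eq_bigr => i _; rewrite linearZ mxE deriveE // mulrC.
Qed.

Lemma is_derive_line f x v (t : R) : differentiable f (x + t *: v) ->
  is_derive t 1 (fun s : R => f (x + s *: v)) (dotp (gradient f (x + t *: v)) v).
Proof.
move=> df.
have quotE : (fun h : R => h^-1 *: (f (x + (h *: 1 + t) *: v) - f (x + t *: v))) =
    (fun h : R => h^-1 *: (f (h *: v + (x + t *: v)) - f (x + t *: v))).
  apply/funext => h; congr (_ *: (f _ - _)).
  by rewrite (_ : h *: 1 = h) ?scalerDl 1?addrCA //; exact: mulr1.
apply: DeriveDef.
  by rewrite /derivable quotE; exact: diff_derivable.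
by rewrite -derive_gradient // /derive quotE.
Qed.

(** The mean value theorem for [psi] replaces integration along the segment; at the intermediate
    point [dpsi] is nonpositive by the Lipschitz bound and Cauchy-Schwarz. *)
Lemma descent f L x y : (forall z, differentiable f z) ->
  (forall z dz, enorm (gradient f (z + dz) - gradient f z) <= L * enorm dz) ->
  `|f y - f x - dotp (gradient f x) (y - x)| <= L / 2 * dotp (y - x) (y - x).
Proof.
move=> df lipf; set v := y - x; set gx := dotp _ v; set N := dotp v v.
(* [s] is 1 or -1, so one argument serves both sides of the absolute value. *)
suff bound (s : R) : s ^+ 2 = 1 -> s * (f y - f x - gx) <= L / 2 * N.
  rewrite ler_norml; have := bound 1 (expr1n _ _); have := bound (-1) (sqrr_sign _ 1%N).
  lra.
move=> s1.
pose psi (t : R) := s * (f (x + t *: v) - t * gx) - L / 2 * N * t ^+ 2.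
pose dpsi (t : R) := s * (dotp (gradient f (x + t *: v)) v - gx) - L * N * t.
have psi' (t : R) : is_derive t (1 : R) psi (dpsi t).
  have dline := is_derive_line (df (x + t *: v)).
  have dlin : is_derive t (1 : R) (gx \*: (id : R -> R)) (gx *: 1).
    exact: (is_deriveZ gx (is_derive_id t (1 : R))).
  have dsqr : is_derive t (1 : R) ((L / 2 * N) \*: ((id : R -> R) ^+ 2))
      ((L / 2 * N) *: ((2%:R * t ^+ 1) *: 1)).
    exact: (is_deriveZ (L / 2 * N) (is_deriveX 2 (is_derive_id t (1 : R)))).
  have := is_deriveB (is_deriveZ s (is_deriveB dline dlin)) dsqr.
  rewrite /GRing.scale /= => dpsi_t.
  rewrite (_ : psi = (s \*: ((fun r : R => f (x + r *: v)) - gx \*: (id : R -> R)) -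
      (L / 2 * N) \*: ((id : R -> R) ^+ 2))); last first.
    by apply/funext => r; rewrite /psi [r * gx]mulrC.
  by apply: (is_derive_eq dpsi_t); rewrite /dpsi; field.
have psi_cont : {within `[0, 1], continuous psi}.
  apply: continuous_subspaceT => t.
  apply: differentiable_continuous; apply/derivable1_diffP.
  exact: (@ex_derive _ _ _ _ _ _ _ (psi' t)).
have [c] := MVT ltr01 (fun t _ => psi' t) psi_cont.
rewrite in_itv /= => /andP[c0 _].
rewrite /psi scale1r scale0r addr0 /v [x + (y - x)]addrC subrK -/v subr0 mulr1 => psi01.
suff : dpsi c <= 0 by move: psi01; lra.
have {psi01} : enorm (s *: (gradient f (x + c *: v) - gradient f x)) <= L * enorm (c *: v).
  by rewrite enormZ -(sqrtr_sqr s) s1 sqrtr1 mul1r lipf.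
rewrite (enormZ c) gtr0_norm // => /(ler_wpM2r (enorm_ge0 v)) lip.
have := le_trans (dotp_le _ _) lip.
rewrite dotpZl dotpBl -/gx -!mulrA -expr2 enorm_sqr -/N /dpsi; lra.
Qed.

(* g stands for the gradient of f in F_{mu,L}. *)
Definition quadratic_bounds mu L f g := forall x y,
  mu / 2 * dotp (y - x) (y - x) <= f y - f x - dotp (g x) (y - x)
    <= L / 2 * dotp (y - x) (y - x).

(** The upper bound is the descent lemma. For the lower one, convexity of [f - mu/2 |.|^2] at
    [x + t v] is compared with the first-order expansion of [f] there, as [t] tends to 0. *)
Lemma smooth_strongly_convexP mu L f : smooth_strongly_convex mu L f ->
  quadratic_bounds mu L f (gradient f).
Proof.
move=> [df lipf cvxf] x y; have des := descent x _ df lipf.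
apply/andP; split; last by have := des y; rewrite ler_norml => /andP[].
set v := y - x; rewrite -subr_le0.
(* [L / 2] is the error of the expansion; [mu / 2] comes from the [t (1 - t)] term of the squared
   norm. *)
apply: (@le0_of_le_sqr _ _ ((L + mu) / 2 * dotp v v)) => t /andP[t0 t1].
have t01 : 0 <= t <= 1 by rewrite !ltW.
have := cvxf (Itv01 (ltW t0) (ltW t1)) y x (in_setT _) (in_setT _).
rewrite convRE /conv /= /unstable.onem !enorm_sqr.
have -> : t *: y + (1 - t) *: x = x + t *: v.
  by apply/rowP => i; rewrite !mxE; ring.
have := des (x + t *: v); rewrite [x + _ - x]addrC addKr dotpZl !dotpZr.
have -> : dotp (x + t *: v) (x + t *: v) =
    t * dotp y y + (1 - t) * dotp x x - t * (1 - t) * dotp v v.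
  rewrite /v; dotp_field.
rewrite ler_norml => /andP[lo _] cvx.
suff : t * (mu / 2 * dotp v v - (f y - f x - dotp (gradient f x) v))
   - t ^+ 2 * ((L + mu) / 2 * dotp v v) <= 0 by lra.
apply: le_trans (_ : (f (x + t *: v) -
     mu / 2 * (t * dotp y y + (1 - t) * dotp x x - t * (1 - t) * dotp v v)) -
   (t * (f y - mu / 2 * dotp y y) + (1 - t) * (f x - mu / 2 * dotp x x)) - 
   (f (x + t *: v) - f x - t * dotp (gradient f x) v + L / 2 * (t * (t * dotp v v))) <= 0).
  by rewrite le_eqVlt; apply/orP; left; apply/eqP; field.
by move: cvx lo; lra.
Qed.

End Smooth.

(** * Interpolation inequalities and their one-step consequences *)

Section GradientStep.
Context {R : realType} {d : nat}.
Local Notation E := 'rV[R]_d.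
Variables (mu L : R) (f : E -> R) (g : E -> E).
Hypothesis fg : quadratic_bounds mu L f g.
Implicit Types x y : E.

Local Notation rho := ((L - mu) / (L + mu)).

(** With [g] the gradient of [f], the increment of the gradient of [f - mu/2 |.|^2] from [x] to
    [y]. *)
Definition shifted_gap x y : E := (g y - g x) - mu *: (y - x).

(* Interpolation inequality of the convex (L - mu)-smooth function
   f - mu/2 |.|^2, with the step e kept free to cover L = mu. *)
Lemma interpolation x y (e : R) :
  (e - (L - mu) * e ^+ 2 / 2) * dotp (shifted_gap x y) (shifted_gap x y) +
    mu / 2 * dotp (y - x) (y - x) <= f y - f x - dotp (g x) (y - x).
Proof.
(* The lower bound at [x] and the upper bound at [y] are compared at the trial point [z]. *)
pose z := y - e *: shifted_gap x y.
have /andP[xz _] := fg x z; have /andP[_ yz] := fg y z.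
suff -> : (e - (L - mu) * e ^+ 2 / 2) *
      dotp (shifted_gap x y) (shifted_gap x y) + mu / 2 * dotp (y - x) (y - x) =
    mu / 2 * dotp (z - x) (z - x) + dotp (g x) (z - x) - dotp (g x) (y - x) -
    dotp (g y) (z - y) - L / 2 * dotp (z - y) (z - y) by lra.
by rewrite /z /shifted_gap; dotp_field.
Qed.

(** [e = 1/(L - mu)] maximizes the coefficient of the squared gap. *)
Lemma interpolation_lt x y : mu < L ->
  (2 * (L - mu))^-1 * dotp (shifted_gap x y) (shifted_gap x y) +
    mu / 2 * dotp (y - x) (y - x) <= f y - f x - dotp (g x) (y - x).
Proof.
move=> ltmuL; have := interpolation x y (L - mu)^-1.
suff -> : (L - mu)^-1 - (L - mu) * (L - mu)^-1 ^+ 2 / 2 = (2 * (L - mu))^-1 by [].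
by field; apply: lt0r_neq0; lra.
Qed.

(** With [L - mu = 0] the coefficient of the squared gap is [e] itself, which is arbitrary, so a
    nonzero gap would violate the interpolation inequality. *)
Lemma shifted_gap_eq0 x y : mu = L -> shifted_gap x y = 0.
Proof.
move=> muL; apply: dotp_eq0; apply/eqP; rewrite eq_le dotp_ge0 andbT leNgt.
apply/negP => p0; set P := dotp _ _ in p0.
pose q := dotp (g y - g x) (y - x) - mu * dotp (y - x) (y - x).
have bnd e : 2 * e * P <= q.
  have := interpolation x y e; have := interpolation y x e.
  rewrite -/P muL subrr mul0r mul0r subr0.
  have -> : shifted_gap y x = -1 *: shifted_gap x y.
    by apply/rowP => i; rewrite !mxE; ring.
  have -> : x - y = -1 *: (y - x) by apply/rowP => i; rewrite !mxE; ring.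
  rewrite !dotpZl !dotpZr -/P /q (dotpBl (g y)) muL; lra.
have := bnd ((q + 1) / (2 * P)).
have -> : 2 * ((q + 1) / (2 * P)) * P = q + 1 by field; rewrite gt_eqF.
lra.
Qed.

(** Adding the interpolation inequalities in both directions gives cocoercivity of the shifted
    gradient, a positive multiple of which is exactly the claim. For [mu = L] the left side is a
    multiple of the vanishing gap. *)
Lemma gradient_step_contraction x y : 0 < mu -> mu <= L ->
  dotp ((x - y) - (2 / (L + mu)) *: (g x - g y))
       ((x - y) - (2 / (L + mu)) *: (g x - g y)) <=
  rho ^+ 2 * dotp (x - y) (x - y).
Proof.
move=> mu_gt0; rewrite le_eqVlt => /predU1P[muL|ltmuL].
  have -> : (x - y) - (2 / (L + mu)) *: (g x - g y) =
      - (2 / (L + mu)) *: shifted_gap y x.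
    apply/rowP => i; rewrite /shifted_gap !mxE muL; field.
    by apply: lt0r_neq0; lra.
  by rewrite shifted_gap_eq0 // scaler0 dotp0 mulr_ge0 ?sqr_ge0 ?dotp_ge0.
have Lmu0 : L - mu != 0 by apply: lt0r_neq0; lra.
have := interpolation_lt x y ltmuL; have := interpolation_lt y x ltmuL.
set P := dotp (shifted_gap y x) (shifted_gap y x).
have -> : dotp (shifted_gap x y) (shifted_gap x y) = P.
  by rewrite /P /shifted_gap; dotp_field.
have -> : dotp (y - x) (y - x) = dotp (x - y) (x - y) by dotp_field.
set N := dotp (x - y) (x - y) => yx xy.
have {xy yx} : 0 <= dotp (g x - g y) (x - y) - mu * N - (L - mu)^-1 * P.
  suff -> : dotp (g x - g y) (x - y) = - (dotp (g x) (y - x) + dotp (g y) (x - y)).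
    have := invfM 2 (L - mu); lra.
  by dotp_field.
have LDmu0 : L + mu != 0 by apply: lt0r_neq0; lra.
have coef_ge0 : 0 <= 4 * (L - mu) / (L + mu) ^+ 2.
  by rewrite divr_ge0 ?sqr_ge0 ?mulr_ge0 ?subr_ge0 ?ltW.
move=> /(mulr_ge0 coef_ge0) gap_ge0; rewrite -subr_ge0; move: gap_ge0.
congr (is_true (0 <= _)); rewrite /N /P /shifted_gap; dotp_field.
all: by rewrite ?Lmu0 ?LDmu0.
Qed.

(* The multipliers below, and the two squares left over, are the dual
   certificate of the performance-estimation problem for function values. *)
Lemma value_step x0 x1 xs (e0 e1 es : R) : 0 < mu -> mu < L ->
  let s1 := ((L + mu) / 2) *: (x0 - x1) - g x0 in
  e1 + dotp s1 (x0 - x1) <= e0 -> e1 + dotp s1 (xs - x1) <= es ->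
  f x1 + e1 - (f xs + es) <= rho ^+ 2 * (f x0 + e0 - (f xs + es)).
Proof.
move=> mu_gt0 ltmuL s1 h01 hs1.
have Lmu_gt0 : 0 < L - mu by lra.
have LDmu_gt0 : 0 < L + mu by lra.
have L_gt0 : 0 < L by lra.
have rho_ge0 : 0 <= rho by rewrite divr_ge0 ?ltW.
have rho_le1 : rho <= 1 by rewrite ler_pdivrMr //; lra.
have rho1_ge0 : 0 <= 1 - rho by lra.
have rho2_ge0 : 0 <= 1 - rho ^+ 2.
  by rewrite subr_ge0 expr_le1.
have A := ler_wpM2l rho_ge0 (interpolation_lt x1 x0 ltmuL).
have B := ler_wpM2l (mulr_ge0 rho_ge0 rho1_ge0) (interpolation_lt x0 xs ltmuL).
have C := ler_wpM2l rho1_ge0 (interpolation_lt x1 xs ltmuL).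
have D := ler_wpM2l (sqr_ge0 rho) h01.
have F := ler_wpM2l rho2_ge0 hs1.
(* With [g] the gradient of [f], these are gradients of [f - mu/2 |. - xs|^2] at [x0] and [x1]. *)
pose p0 := g x0 - mu *: (x0 - xs); pose p1 := g x1 - mu *: (x1 - xs).
pose u := rho *: (x0 - xs) - (x1 - xs) + L^-1 *: (p1 - p0).
pose v := (2 / (L + mu)) *: g xs - L^-1 *: (rho *: p0 + p1).
have U : 0 <= L / 2 * dotp u u by rewrite mulr_ge0 ?dotp_ge0 // divr_ge0 // ltW.
have V : 0 <= L * mu / (2 * (L - mu)) * dotp v v.
  by rewrite mulr_ge0 ?dotp_ge0 // divr_ge0 ?mulr_ge0 // ltW.
have cert :
    rho * ((2 * (L - mu))^-1 * dotp (shifted_gap x1 x0) (shifted_gap x1 x0) +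
       mu / 2 * dotp (x0 - x1) (x0 - x1) + dotp (g x1) (x0 - x1)) +
    rho * (1 - rho) *
      ((2 * (L - mu))^-1 * dotp (shifted_gap x0 xs) (shifted_gap x0 xs) +
       mu / 2 * dotp (xs - x0) (xs - x0) + dotp (g x0) (xs - x0)) +
    (1 - rho) *
      ((2 * (L - mu))^-1 * dotp (shifted_gap x1 xs) (shifted_gap x1 xs) +
       mu / 2 * dotp (xs - x1) (xs - x1) + dotp (g x1) (xs - x1)) +
    rho ^+ 2 * dotp s1 (x0 - x1) + (1 - rho ^+ 2) * dotp s1 (xs - x1) =
    L / 2 * dotp u u + L * mu / (2 * (L - mu)) * dotp v v.
  rewrite /u /v /p0 /p1 /s1 /shifted_gap; dotp_field.
  by rewrite !gt_eqF.
move: A B C D F U V cert; set r := rho.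
move: (dotp u u) (dotp v v) => {}U {}V; lra.
Qed.

End GradientStep.

(** * Existence of minimizers, subdifferentials and the proximal operator *)

(** Weierstrass for lower semicontinuous functions: the nonempty sublevel sets in [K] generate a
    proper filter, and being closed they all contain its cluster point. *)
Lemma lsc_min (R : realType) (T : topologicalType) (G : T -> \bar R) (K : set T)
    (x0 : T) : compact K -> (forall r : R, closed [set x | (G x <= r%:E)%E]) ->
  K x0 -> (G x0 < +oo)%E -> exists2 x, K x & forall y, K y -> (G x <= G y)%E.
Proof.
move=> cK clG Kx0 Gx0; pose B (r : R) := K `&` [set x | (G x <= r%:E)%E].
pose D := [set r | B r !=set0].
have D0 : exists r, D r.
  case Er : (G x0) Gx0 => [r||] // _; [exists r|exists 0];
    by exists x0; split => //=; rewrite Er ?leNye.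
have FF : ProperFilter (filter_from D B).
  apply: filter_from_proper => //; apply: filter_from_filter => // i j Di Dj.
  exists (Num.min i j); first by rewrite /Num.min; case: ifP.
  by move=> x [Kx /= xij]; split; split => //=; rewrite (le_trans xij) // lee_fin
    ge_min lexx ?orbT.
have [|x [Kx clx]] := cK _ FF.
  by have [r Dr] := D0; exists r => // y [].
have Gx r : D r -> (G x <= r%:E)%E.
  move=> Dr; have : closure [set z | (G z <= r%:E)%E] x.
    move=> V Vx; apply: clx Vx; exists r => // z [] //.
  by have /closure_id <- := clG r.
exists x => // y Ky; case Gy : (G y) => [r||]; last 2 first.
- by rewrite leey.
(* If [G y] is [-oo], every real level is reached, so [G x] lies below all reals. *)
- have {}Gx r : (G x <= r%:E)%E by apply: Gx; exists y; split => //=; rewrite Gy leNye.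
  case: (G x) Gx => [s||//] Gx; first by have := Gx (s - 1); rewrite lee_fin lerBrDr gerDl ler10.
  by have := Gx 0.
- by apply: Gx; exists y; split; rewrite //= Gy.
Qed.

Section ConvexMinimization.
Context {R : realType} {d : nat}.
Local Notation E := 'rV[R]_d.
Implicit Types (x y v : E) (q : E -> R) (h : E -> \bar R).

(** The sublevel set is the preimage of the epigraph of [h] under the continuous map sending [x] to
    [(x, r - q x)]. *)
Lemma closed_sublevel_composite q h (r : R) : continuous q ->
  closed (epigraph h) -> closed [set x | (composite q h x <= r%:E)%E].
Proof.
move=> cq clh.
rewrite (_ : [set _ | _] = (fun x => (x, r - q x)) @^-1` epigraph h).
  apply: closed_comp clh => x _.
  have cp : {for x, continuous (fun y => r - q y)}.
    by apply: continuousB; [exact: cst_continuous|exact: cq].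
  exact: (@cvg_pair _ _ _ (nbhs x) (nbhs x) (nbhs (r - q x)) _ _ _ _ _ (@cvg_id _ _) cp).
by apply/seteqP; split => x; rewrite /composite /epigraph /= EFinB leeBrDl.
Qed.

Lemma proper_finite h x y : closed_proper_convex h ->
  (h x <= h y)%E -> (h y < +oo)%E -> h x = (fine (h x))%:E.
Proof.
move=> [_ hN _ _] hxy hy; have := hN x.
by case: (h x) (le_lt_trans hxy hy).
Qed.

Lemma convex_extP h x y (t a b : R) : convex_ext h -> 0 < t < 1 ->
  h x = a%:E -> h y = b%:E ->
  (h (t *: x + (1 - t) *: y)%R <= (t * a + (1 - t) * b)%:E)%E.
Proof. by move=> cvx t01 hx hy; have := cvx x y t t01; rewrite hx hy. Qed.

(* Outside the unit ball around x0, convexity along the segment to x0 bounds h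
   below by an affine function of the distance, which the quadratic growth of q
   dominates; this makes separation arguments unnecessary. *)
Lemma composite_has_min q h (g : E -> E) (c : R) : 0 < c -> continuous q ->
  (forall x y, c * dotp (y - x) (y - x) <= q y - q x - dotp (g x) (y - x)) ->
  closed_proper_convex h -> exists x, forall y, (composite q h x <= composite q h y)%E.
Proof.
move=> c0 cq growth cpc; have [clh hN [x0 hx0] cvx] := cpc.
have {}hx0 : (h x0 < +oo)%E by rewrite lt_neqAle hx0 leey.
have c00 : continuous (fun _ : E => 0 : R) by exact: cst_continuous.
have ball0 (r : R) : 0 <= r -> dotp (x0 - x0) (x0 - x0) <= r ^+ 2.
  by rewrite subrr dotp0 => _; rewrite sqr_ge0.
have [z _ zmin] : exists2 z, dotp (x0 - z) (x0 - z) <= 1 ^+ 2 & forall y,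
    dotp (x0 - y) (x0 - y) <= 1 ^+ 2 -> (h z <= h y)%E.
  apply: (@lsc_min _ _ h [set y | dotp (x0 - y) (x0 - y) <= 1 ^+ 2] x0) => //=.
  - exact: closed_eball_compact.
  - move=> r; have := @closed_sublevel_composite _ h r c00 clh.
    by congr closed; apply/seteqP; split => y; rewrite /= /composite add0e.
  - exact: ball0.
have Ex0 := proper_finite cpc (lexx _) hx0.
have Ez := proper_finite cpc (zmin x0 (ball0 1 ler01)) hx0.
set h0 := fine (h x0) in Ex0; set m := fine (h z) in Ez.
have mh0 : m <= h0 by have := zmin x0 (ball0 1 ler01); rewrite Ex0 Ez lee_fin.
(* Beyond distance [r0] the growth [c r^2] exceeds the possible loss [r (G + h0 - m)]; the summand 1
   keeps the unit ball inside. *)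
pose G := enorm (g x0); pose r0 := 1 + (G + (h0 - m)) / c.
have G0 : 0 <= G by exact: enorm_ge0.
have r01 : 1 <= r0 by rewrite lerDl divr_ge0 ?(ltW c0) // addr_ge0 ?subr_ge0.
have [x xr xmin] : exists2 x, dotp (x0 - x) (x0 - x) <= r0 ^+ 2 & forall y,
    dotp (x0 - y) (x0 - y) <= r0 ^+ 2 -> (composite q h x <= composite q h y)%E.
  apply: (@lsc_min _ _ (composite q h)
    [set y | dotp (x0 - y) (x0 - y) <= r0 ^+ 2] x0) => /=.
  - exact: closed_eball_compact.
  - by move=> r; exact: closed_sublevel_composite.
  - by apply: ball0; lra.
  - by rewrite /composite Ex0 -EFinD ltry.
exists x => y; have [|yr] := leP (dotp (x0 - y) (x0 - y)) (r0 ^+ 2); first exact: xmin.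
apply: le_trans (xmin x0 (ball0 r0 _)) _; first by lra.
rewrite /composite Ex0; case Ey : (h y) (hN y) => [b||] // _; last by rewrite leey.
rewrite -!EFinD lee_fin.
pose r := enorm (y - x0).
have rE : r ^+ 2 = dotp (x0 - y) (x0 - y) by rewrite /r enorm_sqr; dotp_field.
have r0r : r0 < r.
  by rewrite -ltr_sqr ?nnegrE ?enorm_ge0 ?rE //; lra.
have r_gt0 : 0 < r by lra.
(* Jensen at the point of the segment from [x0] to [y] at distance 1 from [x0], where [h] is at
   least [m]. *)
have segm : m <= r^-1 * b + (1 - r^-1) * h0.
  have r01' : 0 < r^-1 < 1 by rewrite invr_gt0 r_gt0 invf_lt1 //; lra.
  rewrite -lee_fin -Ez (le_trans _ (convex_extP cvx r01' Ey Ex0)) //.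
  apply: zmin.
  rewrite (_ : dotp _ _ = (r^-1) ^+ 2 * dotp (x0 - y) (x0 - y)).
    by rewrite -rE -exprMn mulVf ?gt_eqF.
  by dotp_field; rewrite ?gt_eqF.
have {}segm : r * m <= b + (r - 1) * h0.
  have := ler_wpM2l (ltW r_gt0) segm.
  rewrite (_ : r * (r^-1 * b + _) = b + (r - 1) * h0) //.
  by field; rewrite gt_eqF.
have := growth x0 y; rewrite (_ : dotp (y - x0) (y - x0) = r ^+ 2); last first.
  by rewrite /r enorm_sqr.
have := dotp_ge (g x0) (y - x0); rewrite -/G -/r => gr grow.
have rr0 : (r0 - 1) * c = G + (h0 - m) by rewrite /r0; field; rewrite gt_eqF.
have : 0 <= r * ((r - r0) * c) by rewrite !mulr_ge0 ?ltW // subr_gt0.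
have rc : 0 < r * c by rewrite mulr_gt0.
have : r * (r0 * c) = r * (c + G + (h0 - m)).
  by congr (r * _); lra.
lra.
Qed.

Lemma argminP (G : E -> \bar R) : (exists x, forall y, (G x <= G y)%E) ->
  forall y, (G (argmin G) <= G y)%E.
Proof. by move=> exG; have := xgetPex 0 exG. Qed.

Lemma argmin_uniq (G : E -> \bar R) x : (forall y, (G x <= G y)%E) ->
  (forall y, y != x -> (G x < G y)%E) -> argmin G = x.
Proof.
move=> xmin xlt; apply: contrapT => /eqP /xlt; apply/negP; rewrite -leNgt.
by apply: argminP; exists x.
Qed.

(** Sum rule: at [x + t (y - x)], the subgradient inequality, convexity of [h] and the quadratic
    bound on [q] give the claim up to an error of order [t^2]. *)
Lemma subdifferential_composite q h x g0 v (C : R) : closed_proper_convex h ->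
  (forall y, q y - q x - dotp g0 (y - x) <= C * dotp (y - x) (y - x)) ->
  subdifferential (composite q h) x v -> subdifferential h x (v - g0).
Proof.
move=> cpc upper sub y; have [_ hN [z hz] cvx] := cpc.
have {}hz : (h z < +oo)%E by rewrite lt_neqAle hz leey.
case Ex : (h x) (hN x) => [a||] // _; last first.
  (* With [h x] infinite, the subgradient inequality at [z] would make [h z] infinite. *)
  by have := sub z; move: hz; rewrite /composite Ex; case: (h z).
case Ey : (h y) (hN y) => [b||] // _; last by rewrite leey.
rewrite -EFinD lee_fin -subr_le0.
apply: (@le0_of_le_sqr _ _ (C * dotp (y - x) (y - x))) => t t01.
have := convex_extP cvx t01 Ey Ex; set w := (_ + _)%R => hw.
have wE : w - x = t *: (y - x) by rewrite /w; apply/rowP => i; rewrite !mxE; ring.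
have := upper w; have := sub w.
rewrite /composite Ex; case: (h w) (hN w) hw => [e||] //= _.
rewrite !lee_fin wE dotpZl !dotpZr (dotpBl v); lra.
Qed.

Lemma subdifferential_finite h x v : closed_proper_convex h ->
  subdifferential h x v -> h x = (fine (h x))%:E.
Proof.
move=> [_ hN [z hz] _] sub; have := sub z; have := hN x.
by case: (h x) => // _; case: (h z) hz.
Qed.

Lemma subdifferential_monotone h x y u v : closed_proper_convex h ->
  subdifferential h x u -> subdifferential h y v -> 0 <= dotp (u - v) (x - y).
Proof.
move=> cpc hu hv; have := hu y; have := hv x.
rewrite (subdifferential_finite cpc hu) (subdifferential_finite cpc hv).
rewrite -!EFinD !lee_fin dotpBl.
have -> : dotp u (y - x) = - dotp u (x - y) by dotp_field.
lra.
Qed.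

(** Fermat's rule: 0 is a subgradient of the composite at a minimizer, and the sum rule applies. *)
Lemma minimizer_subdifferential q h x g0 (C : R) : closed_proper_convex h ->
  (forall y, q y - q x - dotp g0 (y - x) <= C * dotp (y - x) (y - x)) ->
  (forall y, (composite q h x <= composite q h y)%E) -> subdifferential h x (- g0).
Proof.
move=> cpc upper xmin; rewrite -sub0r; apply: subdifferential_composite upper _ => // y.
by rewrite dotpC dotp0 adde0.
Qed.

Lemma prox_subdifferential (gamma : R) h x : 0 < gamma -> closed_proper_convex h ->
  subdifferential h (prox gamma h x) (gamma^-1 *: (x - prox gamma h x)).
Proof.
move=> gamma0 cpc; set z := prox gamma h x.
pose q y := (2 * gamma)^-1 * dotp (x - y) (x - y).
have g2 : 0 < (2 * gamma)^-1 by rewrite invr_gt0 mulr_gt0.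
have gq y w : q w - q y - dotp (gamma^-1 *: (y - x)) (w - y) =
    (2 * gamma)^-1 * dotp (w - y) (w - y).
  by rewrite /q; dotp_field; rewrite gt_eqF.
have cq : continuous q.
  move=> y; apply: (@continuousM R E (fun=> (2 * gamma)^-1)
    (fun z => dotp (x - z) (x - z))); first exact: cst_continuous.
  exact: sqr_dist_continuous.
have qmin : exists y, forall w, (composite q h y <= composite q h w)%E.
  apply: (@composite_has_min q h (fun y => gamma^-1 *: (y - x)) _ g2) => // y w.
  by rewrite gq.
have -> : gamma^-1 *: (x - z) = - (gamma^-1 *: (z - x)) by rewrite -scalerN opprB.
apply: (@minimizer_subdifferential q _ _ _ (2 * gamma)^-1) => // [y|]; first by rewrite gq.
(* The objective of [prox] is [gamma] times this composite, so the minimizers are the same and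
   [argmin] picks the same point. *)
have GE y : (gamma%:E * h y + (2^-1 * enorm (x - y) ^+ 2)%:E =
    gamma%:E * composite q h y)%E.
  rewrite muleDr ?fin_num_adde_defr // -EFinM addeC; congr (_%:E + _)%E.
  by rewrite /q enorm_sqr; field; rewrite gt_eqF.
have GEq : (fun y => (gamma%:E * h y + (2^-1 * enorm (x - y) ^+ 2)%:E)%E) =
    (fun y => (gamma%:E * composite q h y)%E) by apply/funext.
have zE : z = argmin (composite q h).
  rewrite /z /prox gt_eqF // GEq /argmin; congr xget.
  apply/seteqP; split => y /= ymin w; have := ymin w; by rewrite lee_pmul2l.
by rewrite zE; exact: argminP.
Qed.

End ConvexMinimization.

(** * Contraction of the proximal gradient method *)

Section ProximalGradient.
Context {R : realType} {d : nat}.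
Local Notation E := 'rV[R]_d.
Variables (mu L : R) (f : E -> R) (h : E -> \bar R).
Hypotheses (fmuL : smooth_strongly_convex mu L f) (cpc : closed_proper_convex h).
Implicit Types x y xs s : E.

Local Notation g := (gradient f).
Local Notation rho := ((L - mu) / (L + mu)).
Local Notation gstar := (2 / (L + mu)).
Local Notation step := (fun gamma x => prox gamma h (x - gamma *: g x)).

Lemma composite_argminP : 0 < mu ->
  forall y, (composite f h (argmin (composite f h)) <= composite f h y)%E.
Proof.
move=> mu0; apply: argminP; have mu20 : 0 < mu / 2 by rewrite divr_gt0.
apply: (composite_has_min mu20 _ _ cpc) => [x|x y].
  by apply: differentiable_continuous; case: fmuL.
by have /andP[lower _] := smooth_strongly_convexP fmuL x y; exact: lower.
Qed.

Lemma upper_bound x y :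
  f y - f x - dotp (g x) (y - x) <= L / 2 * dotp (y - x) (y - x).
Proof. by case/andP: (smooth_strongly_convexP fmuL x y). Qed.

Lemma step_subdifferential gamma x : 0 < gamma ->
  subdifferential h (step gamma x) (gamma^-1 *: (x - step gamma x) - g x).
Proof.
move=> gamma0; have := prox_subdifferential (x - gamma *: g x) gamma0 cpc.
congr (subdifferential _ _ _); apply/rowP => i; rewrite !mxE.
by field; rewrite gt_eqF.
Qed.

(** With [u] the difference of the gradient steps at [x] and [xs], and [w = z - xs], monotonicity
    gives [<u - w, w> >= 0], hence [|w| <= |u|]. *)
Lemma step_dist x xs : 0 < mu -> mu <= L -> subdifferential h xs (- g xs) ->
  dotp (step gstar x - xs) (step gstar x - xs) <= rho ^+ 2 * dotp (x - xs) (x - xs).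
Proof.
move=> mu0 muL hs; have gam0 : 0 < gstar by rewrite divr_gt0 //; lra.
apply: le_trans (gradient_step_contraction (smooth_strongly_convexP fmuL) x xs mu0 muL).
have := subdifferential_monotone cpc (step_subdifferential x gam0) hs.
set u := (x - xs) - gstar *: (g x - g xs).
set z := step gstar x; set w := z - xs => mono.
have : 0 <= dotp (u - w) w.
  have -> : u - w = gstar *: (gstar^-1 *: (x - z) - g x - - g xs).
    by apply/rowP => i; rewrite /u /w !mxE; field; rewrite /= gt_eqF //; lra.
  by rewrite dotpZl mulr_ge0 // ltW.
have := dotp_ge0 (u - w).
suff -> : dotp u u = dotp w w + dotp (u - w) (u - w) + 2 * dotp (u - w) w by lra.
by clearbody u w; dotp_field.
Qed.

Lemma step_gradient x s (z := step gstar x) :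
  0 < mu -> mu <= L -> subdifferential h x s ->
  dotp (g z + (gstar^-1 *: (x - z) - g x)) (g z + (gstar^-1 *: (x - z) - g x))
    <= rho ^+ 2 * dotp (g x + s) (g x + s).
Proof.
move=> mu0 muL hs; have LDmu0 : 0 < L + mu by lra.
have gam0 : 0 < gstar by rewrite divr_gt0.
have := subdifferential_monotone cpc hs (step_subdifferential x gam0).
rewrite -/z; set s1 := gstar^-1 *: (x - z) - g x => mono.
have {mono} : 0 <= dotp (s - s1) (g x + s1).
  have -> : g x + s1 = gstar^-1 *: (x - z) by rewrite /s1 addrC subrK.
  by rewrite dotpZr mulr_ge0 // invr_ge0 ltW.
have := dotp_ge0 (s - s1).
(* This expansion turns monotonicity into [|g x + s1| <= |g x + s|]. *)
have -> : dotp (s - s1) (s - s1) = dotp (g x + s) (g x + s) -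
    dotp (g x + s1) (g x + s1) - 2 * dotp (s - s1) (g x + s1).
  by clearbody s1; dotp_field.
move=> d1 d2; have {d1 d2} : dotp (g x + s1) (g x + s1) <= dotp (g x + s) (g x + s).
  by lra.
move=> /(ler_wpM2l (sqr_ge0 rho)); apply: le_trans.
have gi0 : 0 <= gstar^-1 ^+ 2 by exact: sqr_ge0.
(* [gstar (g z + s1)] is the difference of the gradient steps at [x] and [z], and
   [gstar (g x + s1) = x - z]. *)
have := ler_wpM2l gi0
  (gradient_step_contraction (smooth_strongly_convexP fmuL) x z mu0 muL).
congr (_ <= _); rewrite /s1; dotp_field; rewrite ?gt_eqF //.
Qed.

(** [value_step] divides by [L - mu]; for [mu = L] the rate is 0 and the step lands on [xs] by
    [step_dist]. *)
Lemma step_value x xs : 0 < mu -> mu <= L -> subdifferential h xs (- g xs) ->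
  h x = (fine (h x))%:E ->
  f (step gstar x) + fine (h (step gstar x)) - (f xs + fine (h xs)) <=
  rho ^+ 2 * (f x + fine (h x) - (f xs + fine (h xs))).
Proof.
move=> mu0; rewrite le_eqVlt => /predU1P[muL hs _|muL hs hx].
  have := step_dist x mu0 _ hs; rewrite muL lexx subrr mul0r expr0n /= !mul0r.
  move=> /(_ isT) dist0; have /eqP : step (2 / (L + L)) x - xs = 0.
    by apply: dotp_eq0; apply/eqP; rewrite eq_le dist0 dotp_ge0.
  by rewrite subr_eq0 => /eqP ->; rewrite subrr.
have LDmu0 : 0 < L + mu by lra.
have gam0 : 0 < gstar by rewrite divr_gt0.
have sub := step_subdifferential x gam0; set z := step gstar x in sub *.
have hz := subdifferential_finite cpc sub; have hxs := subdifferential_finite cpc hs.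
move: sub; rewrite invf_div => sub.
apply: (value_step (smooth_strongly_convexP fmuL)) => //.
  by have := sub x; rewrite hz hx -EFinD lee_fin.
by have := sub xs; rewrite hz hxs -EFinD lee_fin.
Qed.

Lemma pgmS gamma x k : pgm gamma f h x k.+1 = step gamma (pgm gamma f h x k).
Proof. by []. Qed.

Lemma argmin_subdifferential (xs := argmin (composite f h)) : 0 < mu ->
  subdifferential h xs (- g xs).
Proof.
by move=> mu0; apply: (minimizer_subdifferential cpc (upper_bound xs));
  exact: composite_argminP.
Qed.

Lemma pgm_dist x k (xs := argmin (composite f h)) : 0 < mu -> mu <= L ->
  enorm (pgm gstar f h x k - xs) ^+ 2 <= rho ^+ (2 * k) * enorm (x - xs) ^+ 2.
Proof.
move=> mu0 muL; rewrite !enorm_sqr.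
elim: k => [|k IH]; first by rewrite muln0 mul1r.
rewrite mulnS exprD -mulrA pgmS.
apply: le_trans (step_dist _ mu0 muL (argmin_subdifferential mu0)) _.
by rewrite ler_wpM2l ?sqr_ge0.
Qed.

(** The induction starts with the subgradient [g0 - g x] of [h] at [x] and continues with those
    produced by the steps. *)
Lemma pgm_gradient x g0 k : 0 < mu -> mu <= L ->
  subdifferential (composite f h) x g0 ->
  enorm (g (pgm gstar f h x k.+1) + prox_subgrad gstar f h x k.+1) ^+ 2 <=
  rho ^+ (2 * k.+1) * enorm g0 ^+ 2.
Proof.
move=> mu0 muL hg0; have gam0 : 0 < gstar by rewrite divr_gt0 //; lra.
have hs0 := subdifferential_composite cpc (upper_bound x) hg0.
rewrite !enorm_sqr; elim: k => [|k IH].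
  have := step_gradient mu0 muL hs0.
  by rewrite [g x + _]addrC subrK.
rewrite mulnS exprD -mulrA.
apply: le_trans (ler_wpM2l (sqr_ge0 _) IH).
by apply: step_gradient => //; exact: step_subdifferential.
Qed.

(** Finiteness of [h] is carried along because [fine] sends infinite values to 0. *)
Lemma pgm_value x k (xs := argmin (composite f h)) (xk := pgm gstar f h x k) :
  0 < mu -> mu <= L -> h x = (fine (h x))%:E ->
  h xk = (fine (h xk))%:E /\
  f xk + fine (h xk) - (f xs + fine (h xs)) <=
    rho ^+ (2 * k) * (f x + fine (h x) - (f xs + fine (h xs))).
Proof.
rewrite {}/xk => mu0 muL hx; have gam0 : 0 < gstar by rewrite divr_gt0 //; lra.
elim: k => [|k [hk IH]]; first by rewrite muln0 mul1r.
split; first exact: subdifferential_finite cpc (step_subdifferential _ gam0).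
rewrite mulnS exprD -mulrA; apply: le_trans (ler_wpM2l (sqr_ge0 _) IH).
by apply: step_value => //; exact: argmin_subdifferential.
Qed.

End ProximalGradient.

(** * The method on quadratics with [h = 0] *)

Section Quadratic.
Context {R : realType} {d : nat}.
Local Notation E := 'rV[R]_d.
Implicit Types (x y : E) (c mu L gamma : R).

Definition quad c : E -> R := fun x => c / 2 * dotp x x.
Local Notation zero := (fun _ : E => 0%E : \bar R).

Lemma gradient_quad c x : gradient (quad c) x = c *: x.
Proof.
apply/rowP => i; rewrite !mxE.
have dsqr := is_deriveZ (c / 2) (sqr_norm_is_derive x (delta_mx 0 i)).
rewrite (_ : quad c = (c / 2) \*: (fun y : E => dotp y y)) // (@derive_val _ _ _ _ _ _ _ dsqr).
rewrite /GRing.scale /= /dotp (bigD1 i) //= mxE !eqxx mulr1 big1 ?addr0; first by field.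
by move=> j ji; rewrite mxE (negPf ji) andbF mulr0.
Qed.

Lemma quad_smooth_strongly_convex c mu L : 0 < mu -> mu <= c -> c <= L ->
  smooth_strongly_convex mu L (quad c).
Proof.
move=> mu0 muc cL; split => [x|x dx|].
- rewrite (_ : quad c = (c / 2) \*: (fun y : E => dotp y y)) //.
  exact/differentiableZ/sqr_norm_differentiable.
- rewrite !gradient_quad -scalerBr [x + dx]addrC addrK enormZ.
  by rewrite ler_wpM2r ?enorm_ge0 // ger0_norm //; lra.
move=> t x y _ _; have s0 : 0 <= t%:num by [].
have s1 : 0 <= 1 - t%:num by rewrite subr_ge0.
rewrite convRE /conv /= /unstable.onem /quad !enorm_sqr -subr_ge0.
set s := t%:num in s0 s1 *; set z : E := s *: x + (1 - s) *: y.
(* The last term is the Jensen gap of [|.|^2]; scaled by [(c - mu) / 2] it yields convexity. *)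
have zE : dotp z z =
    s * dotp x x + (1 - s) * dotp y y - s * (1 - s) * dotp (x - y) (x - y).
  by rewrite /z; dotp_field.
have := mulr_ge0 (mulr_ge0 s0 s1) (dotp_ge0 (x - y)).
have cmu : 0 <= (c - mu) / 2 by lra.
by move=> /(mulr_ge0 cmu); rewrite zE; lra.
Qed.

Lemma zero_closed_proper_convex : closed_proper_convex zero.
Proof.
split => //; last by move=> x y t _; rewrite !mule0 adde0.
  rewrite (_ : epigraph _ = snd @^-1` [set r | 0 <= r]).
    by apply: closed_comp (@closed_ge _ 0) => p _; exact: cvg_snd.
  by apply/seteqP; split => p; rewrite /epigraph /= lee_fin.
by exists 0.
Qed.

Lemma dotp_gt0 x : x != 0 -> 0 < dotp x x.
Proof.
by move=> x0; rewrite lt_neqAle dotp_ge0 andbT eq_sym; apply: contra_neq x0 => /dotp_eq0.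
Qed.

Lemma argmin_quad c : 0 < c -> argmin (composite (quad c) zero) = 0.
Proof.
move=> c0; apply: argmin_uniq => y; rewrite /composite !adde0 /quad dotp0 mulr0.
  by rewrite lee_fin mulr_ge0 ?dotp_ge0 // divr_ge0 // ltW.
by move=> y0; rewrite lte_fin mulr_gt0 ?dotp_gt0 // divr_gt0.
Qed.

Lemma prox_zero gamma x : prox gamma zero x = x.
Proof.
rewrite /prox; case: ifP => // _; apply: argmin_uniq => y;
  rewrite !mule0 !add0e !enorm_sqr subrr dotp0 mulr0.
  by rewrite lee_fin mulr_ge0 ?dotp_ge0.
by move=> yx; rewrite lte_fin mulr_gt0 ?dotp_gt0 // subr_eq0 eq_sym.
Qed.

Lemma pgm_quad gamma c x k :
  pgm gamma (quad c) zero x k = (1 - gamma * c) ^+ k *: x.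
Proof.
elim: k => [|k IH]; first by rewrite scale1r.
rewrite pgmS IH prox_zero gradient_quad exprS -!scalerA scalerBl scale1r -scalerA.
by [].
Qed.

End Quadratic.

(** * Lower and upper bounds on the worst cases *)

Section WorstCaseValues.
Context {R : realType}.
Variables (d k : nat) (mu L : R).
Hypotheses (d_gt0 : (0 < d)%N) (mu_gt0 : 0 < mu).
Implicit Types (c gamma : R).

Local Notation ones := (const_mx 1 : 'rV[R]_d).
Local Notation zero := (fun _ : 'rV[R]_d => 0%E : \bar R).

(** The extremal examples start at a nonzero point, available because [d] is positive. *)
Let ones_gt0 : 0 < dotp ones ones.
Proof.
apply: dotp_gt0; apply/eqP => /rowP /(_ (Ordinal d_gt0)) /eqP.
by rewrite !mxE oner_eq0.
Qed.

Lemma W1_ge c gamma : mu <= c -> c <= L ->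
  (((1 - gamma * c) ^+ (2 * k))%:E <= W1 d mu L k gamma)%E.
Proof.
move=> muc cL; have c0 := lt_le_trans mu_gt0 muc.
apply: ereal_sup_ubound; exists (quad c), zero, ones => /=.
rewrite argmin_quad // pgm_quad !subr0 !enorm_sqr dotpZl dotpZr.
split; [exact: quad_smooth_strongly_convex|exact: zero_closed_proper_convex|exact: lt0r_neq0|].
by congr _%:E; rewrite mulnC exprM; field; rewrite gt_eqF.
Qed.

Lemma W2_ge c gamma : (0 < k)%N -> 0 < gamma -> mu <= c -> c <= L ->
  (((1 - gamma * c) ^+ (2 * k))%:E <= W2 d mu L k gamma)%E.
Proof.
case: k => // j _ gamma0 muc cL; have c0 := lt_le_trans mu_gt0 muc.
apply: ereal_sup_ubound; exists (quad c), zero, ones, (c *: ones).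
(* For [h = 0] the recovered subgradient vanishes. *)
have s0 : prox_subgrad gamma (quad c) zero ones j.+1 = 0.
  rewrite /prox_subgrad !pgm_quad gradient_quad; apply/rowP => i; rewrite !mxE exprS.
  by field; rewrite gt_eqF.
split; [exact: quad_smooth_strongly_convex|exact: zero_closed_proper_convex| | |].
- move=> y; rewrite /composite !adde0 lee_fin /quad -subr_ge0.
  rewrite (_ : _ - _ = c / 2 * dotp (y - ones) (y - ones)); last by dotp_field.
  by rewrite mulr_ge0 ?dotp_ge0 // divr_ge0 // ltW.
- by rewrite enorm_sqr dotpZl dotpZr !mulf_neq0 // gt_eqF.
rewrite s0 addr0 gradient_quad pgm_quad !enorm_sqr !dotpZl !dotpZr mulnC exprM.
by congr _%:E; field; rewrite !gt_eqF.
Qed.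

Lemma W3_ge c gamma : mu <= c -> c <= L ->
  (((1 - gamma * c) ^+ (2 * k))%:E <= W3 d mu L k gamma)%E.
Proof.
move=> muc cL; have c0 := lt_le_trans mu_gt0 muc.
apply: ereal_sup_ubound; exists (quad c), zero, ones => /=.
rewrite argmin_quad // pgm_quad /composite !adde0 /quad dotp0 dotpZl dotpZr
  mulr0 -!EFinD addr0 oppr0 !addr0.
have den0 : c / 2 * dotp ones ones != 0 by rewrite !mulf_neq0 ?invr_neq0 // gt_eqF.
split; [exact: quad_smooth_strongly_convex|exact: zero_closed_proper_convex| | |] => //.
rewrite inver (negPf den0) -EFinM; congr _%:E.
by rewrite mulnC exprM; field; rewrite !gt_eqF.
Qed.

Local Notation gstar := (2 / (L + mu)).
Local Notation rho := ((L - mu) / (L + mu)).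

(* On one side of gstar the curvature mu is the worst case, on the other L. *)
Lemma rate_le_curvature gamma : mu <= L -> exists c,
  [/\ mu <= c, c <= L & rho ^+ (2 * k) <= (1 - gamma * c) ^+ (2 * k)].
Proof.
move=> muL; have LDmu0 : 0 < L + mu by have := mu_gt0; lra.
have rho0 : 0 <= rho by rewrite divr_ge0 ?subr_ge0 // ltW.
have [gle|glt] := leP gamma gstar.
  exists mu; split => //.
  have rE : rho = 1 - gstar * mu by field; rewrite gt_eqF.
  have : rho <= 1 - gamma * mu by rewrite rE lerD2l lerN2 ler_pM2r.
  by move=> le; rewrite lerXn2r ?nnegrE // (le_trans rho0).
(* Here [1 - gamma L <= - rho]; the even exponent removes the sign. *)
exists L; split => //; rewrite !exprM.
have rE : rho = gstar * L - 1 by field; rewrite gt_eqF.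
have L0 : 0 <= L by have := mu_gt0; lra.
have le : rho <= gamma * L - 1 by rewrite rE lerD2r ler_wpM2r // ltW.
by rewrite -(sqrrN (1 - _)) opprB lerXn2r ?nnegrE ?sqr_ge0 // lerXn2r ?nnegrE ?(le_trans rho0).
Qed.

Lemma W1_gstar_le : mu <= L -> (W1 d mu L k gstar <= (rho ^+ (2 * k))%:E)%E.
Proof.
move=> muL; apply: ge_ereal_sup => _ [f [h [x [fmuL cpc x0 ->]]]].
rewrite lee_fin ler_pdivrMr; first exact: pgm_dist.
by rewrite lt_neqAle eq_sym x0 sqr_ge0.
Qed.

Lemma W2_gstar_le : (0 < k)%N -> mu <= L ->
  (W2 d mu L k gstar <= (rho ^+ (2 * k))%:E)%E.
Proof.
case: k => // j _ muL; apply: ge_ereal_sup => _ [f [h [x [g0 [fmuL cpc hg0 g00 ->]]]]].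
rewrite lee_fin ler_pdivrMr; first exact: pgm_gradient.
by rewrite lt_neqAle eq_sym g00 sqr_ge0.
Qed.

Lemma W3_gstar_le : mu <= L -> (W3 d mu L k gstar <= (rho ^+ (2 * k))%:E)%E.
Proof.
move=> muL; apply: ge_ereal_sup => _ [f [h [x [fmuL cpc F0 Ffin ->]]]].
move: F0 Ffin; have := composite_argminP fmuL cpc mu_gt0 x.
have := subdifferential_finite cpc (argmin_subdifferential fmuL cpc mu_gt0).
have := @pgm_value _ _ _ _ _ _ fmuL cpc x k mu_gt0 muL.
set xs := argmin _; set xk := pgm _ _ _ _ _; rewrite /composite => value hs.
(* A finite denominator excludes [h x = +oo]. *)
rewrite hs => FsFx F0 Ffin; have hx : h x = (fine (h x))%:E.
  by have [_ hN _ _] := cpc; move: Ffin (hN x); case: (h x).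
have [hk le] := value hx; move: FsFx F0; rewrite hx hk -!EFinD.
rewrite lee_fin -subr_ge0 => FsFx F0.
have {}F0 : f x + fine (h x) - (f xs + fine (h xs)) != 0.
  by apply: contra_neq F0 => ->.
rewrite inver (negPf F0) -EFinM lee_fin ler_pdivrMr //.
by rewrite lt_neqAle eq_sym F0.
Qed.

End WorstCaseValues.

Theorem mainTheorem3 (R : realType) (d k : nat) (mu L : R)
    (hd : (1 <= d)%N) (hk : (1 <= k)%N) (hmu : 0 < mu) (hL : mu <= L) :
  let gstar := 2 / (L + mu) in
  let rate := (((L - mu) / (L + mu)) ^+ (2 * k))%:E in
  [/\ minimizes_over (W1 d mu L k) [set g | 0 <= g <= 2 / L] gstar,
      minimizes_over (W2 d mu L k) [set g | 0 < g <= 2 / L] gstar &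
      minimizes_over (W3 d mu L k) [set g | 0 <= g <= 2 / L] gstar] /\
  [/\ W1 d mu L k gstar = rate,
      W2 d mu L k gstar = rate &
      W3 d mu L k gstar = rate].
Proof.
move=> gstar rate; have gstar_gt0 : 0 < gstar by rewrite divr_gt0 //; lra.
have gstar_le : gstar <= 2 / L.
  by rewrite ler_pM2l // lef_pV2 ?posrE; lra.
(* The rate bounds each worst case from below over its range of step sizes, so attaining it at
   [gstar] gives both the value and minimality. *)
have W1_rate gamma : (rate <= W1 d mu L k gamma)%E.
  have [c [muc cL le]] := rate_le_curvature k hmu gamma hL.
  by apply: le_trans (W1_ge _ hd hmu gamma muc cL); rewrite lee_fin.
have W2_rate gamma : 0 < gamma -> (rate <= W2 d mu L k gamma)%E.
  move=> gamma0; have [c [muc cL le]] := rate_le_curvature k hmu gamma hL.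
  by apply: le_trans (W2_ge hd hmu hk gamma0 muc cL); rewrite lee_fin.
have W3_rate gamma : (rate <= W3 d mu L k gamma)%E.
  have [c [muc cL le]] := rate_le_curvature k hmu gamma hL.
  by apply: le_trans (W3_ge _ hd hmu gamma muc cL); rewrite lee_fin.
have W1E : W1 d mu L k gstar = rate by apply/eqP; rewrite eq_le W1_gstar_le /=.
have W2E : W2 d mu L k gstar = rate by apply/eqP; rewrite eq_le W2_gstar_le /= ?W2_rate.
have W3E : W3 d mu L k gstar = rate by apply/eqP; rewrite eq_le W3_gstar_le /=.
have W1_min : minimizes_over (W1 d mu L k) [set g | 0 <= g <= 2 / L] gstar.
  by split=> [|gamma _]; [rewrite /= gstar_le ltW|rewrite W1E W1_rate].
have W2_min : minimizes_over (W2 d mu L k) [set g | 0 < g <= 2 / L] gstar.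
  split=> [|gamma /andP[gamma0 _]]; last by rewrite W2E W2_rate.
  by rewrite /= gstar_le gstar_gt0.
have W3_min : minimizes_over (W3 d mu L k) [set g | 0 <= g <= 2 / L] gstar.
  by split=> [|gamma _]; [rewrite /= gstar_le ltW|rewrite W3E W3_rate].
exact: (conj (And3 W1_min W2_min W3_min) (And3 W1E W2E W3E)).
Qed.
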